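(* Let $\mathcal F$ be a family of at most $5$ line-segments in $\mathbb{R}^2$ whose relative interiors are pairwise disjoint, and let $M\subset\mathbb{R}^2$ be a set with $M\supseteq\bigcup\mathcal F$ such that $M\setminus\bigcup\mathcal F$ is finite. If no line meets $M$ in exactly two points, then $M$ is contained in a line.
   Context: Line-segments are closed and nondegenerate (of positive length). *)

(* Defs.v *)
From HB Require Export structures.
From mathcomp Require Export all_boot all_order all_algebra.
From mathcomp Require Export boolp classical_sets functions cardinality.
From mathcomp Require Export set_interval reals.

Set Implicit Arguments.
Unset Strict Implicit.
Unset Printing Implicit Defensive.

Import Order.TTheory GRing.Theory Num.Theory.

Local Open Scope classical_set_scope.
Local Open Scope ring_scope.

Section PlaneGeometry.
Variable R : realType.

(* Nondegeneracy of a segment is the separate condition a <> b on its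
   endpoints. *)
Definition segment (a b : 'rV[R]_2) : set 'rV[R]_2 :=
  [set (1 - t) *: a + t *: b | t in `[0, 1]].

(* For a <> b this is the relative interior of segment a b. When a = b it is
   {a}. *)
Definition segment_relint (a b : 'rV[R]_2) : set 'rV[R]_2 :=
  [set (1 - t) *: a + t *: b | t in `]0, 1[].

Definition is_line (L : set 'rV[R]_2) : Prop :=
  exists p v : 'rV[R]_2, v <> 0 /\ L = [set p + t *: v | t in [set: R]].

End PlaneGeometry.

(* Main.v *)
(** Suppose the segment endpoints are not collinear, and let [e] be a vertex of
    their convex hull. A line cutting off [e] closely meets the segments ending
    at [e] and nothing else, so [e] is not an endpoint of exactly two segments.
    If only one segment [[e, w]] ended at [e], let [f] be the first endpoint
    after [e] on a supporting line through [e] that avoids [w]: tilting that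
    line slightly about [f] gives a line meeting [M] only in [f] and in one
    point of [[e, w]]. So at least three segments end at each hull vertex;
    there are at least three such vertices and two of them share at most one
    segment, which requires six segments. If all segments lie on a line and [M]
    has a point off it, a generic line through that point is ordinary. If there
    are no segments, this is the Sylvester-Gallai theorem. *)
Require Import Defs.
From mathcomp Require Import ring lra zify.

Set Implicit Arguments.
Unset Strict Implicit.
Unset Printing Implicit Defensive.

Import Order.TTheory GRing.Theory Num.Theory.

Local Open Scope classical_set_scope.
Local Open Scope ring_scope.

Section Plane.
Variable R : realType.
Implicit Types (u v x y z a b : 'rV[R]_2) (c s t : R).

(** * The dot product and the quarter turn in the plane *)

Definition dot u x : R := u 0 0 * x 0 0 + u 0 1 * x 0 1.

Definition perp u : 'rV[R]_2 := \row_(j < 2) if j == 0 then - u 0 1 else u 0 0.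

Lemma perp0 u : perp u 0 0 = - u 0 1. Proof. by rewrite mxE. Qed.
Lemma perp1 u : perp u 0 1 = u 0 0. Proof. by rewrite mxE. Qed.

Lemma rV2_eq x y : x 0 0 = y 0 0 -> x 0 1 = y 0 1 -> x = y.
Proof.
move=> h0 h1; apply/rowP => j.
have [->|->] : j = 0 \/ j = 1 by case: j => [[|[|k]] hk] //; [left|right]; apply: val_inj.
- exact: h0.
- exact: h1.
Qed.

Lemma dotDr u x y : dot u (x + y) = dot u x + dot u y.
Proof. by rewrite /dot !mxE; ring. Qed.

Lemma dotBr u x y : dot u (x - y) = dot u x - dot u y.
Proof. by rewrite /dot !mxE; ring. Qed.

Lemma dotZr u c x : dot u (c *: x) = c * dot u x.
Proof. by rewrite /dot !mxE; ring. Qed.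

Lemma dotDl u v x : dot (u + v) x = dot u x + dot v x.
Proof. by rewrite /dot !mxE; ring. Qed.

Lemma dotZl u c x : dot (c *: u) x = c * dot u x.
Proof. by rewrite /dot !mxE; ring. Qed.

Lemma dotNl u x : dot (- u) x = - dot u x.
Proof. by rewrite /dot !mxE; ring. Qed.

Lemma dotC u x : dot u x = dot x u.
Proof. by rewrite /dot; ring. Qed.

Lemma dot_perp u v : dot (perp u) v = - dot (perp v) u.
Proof. by rewrite /dot !perp0 !perp1; ring. Qed.

Lemma dot_perp_id u : dot (perp u) u = 0.
Proof. by rewrite /dot perp0 perp1; ring. Qed.

Lemma dot_gt0 u : u != 0 -> 0 < dot u u.
Proof.
move=> u0; rewrite lt_neqAle; apply/andP; split; last by rewrite /dot; nra.
apply: contra_neq u0 => h; apply: rV2_eq; rewrite mxE; move: h; rewrite /dot; nra.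
Qed.

Lemma perp_neq0 u : u != 0 -> perp u != 0.
Proof.
apply: contra_neq => /rowP h; have := (h 0, h 1); rewrite !mxE /=.
by case=> h1 h0; apply: rV2_eq; rewrite mxE; lra.
Qed.

(** Expansion in the orthogonal basis [u], [perp u], multiplied by [dot u u] to avoid division. *)
Lemma dot_perp_decomp u x : dot u u *: x = dot u x *: u + dot (perp u) x *: perp u.
Proof.
by apply: rV2_eq; rewrite !mxE /= /dot ?perp0 ?perp1; ring.
Qed.

Lemma dot_eq0 u x : u != 0 -> dot u x = 0 -> dot (perp u) x = 0 -> x = 0.
Proof.
move=> u0 h1 h2; have := dot_perp_decomp u x.
rewrite h1 h2 !scale0r addr0 => /eqP; rewrite scaler_eq0 gt_eqF ?dot_gt0 //=.
by move/eqP.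
Qed.

(** The first two hypotheses make [y] a multiple of [x]. *)
Lemma dot_parallel u x y : x != 0 -> dot (perp x) y = 0 -> dot u x = 0 -> dot u y = 0.
Proof.
move=> x0 hy hx; have := congr1 (dot u) (dot_perp_decomp x y).
rewrite hy scale0r addr0 !dotZr hx mulr0 => /eqP.
by rewrite mulf_eq0 (gt_eqF (dot_gt0 x0)) => /eqP.
Qed.

(** * Lines as level sets, collinearity and ordinary lines *)

Lemma is_line_level u c : u != 0 -> is_line [set x | dot u x = c].
Proof.
move=> u0; have N0 : dot u u != 0 by rewrite gt_eqF // dot_gt0.
exists ((c / dot u u) *: u), (perp u); split; first by apply/eqP/perp_neq0.
apply/seteqP; split => x /=.
  move=> hx; exists (dot (perp u) x / dot u u) => //.
  apply: (scalerI N0); rewrite [RHS]dot_perp_decomp hx scalerDr !scalerA.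
  by congr (_ *: _ + _ *: _); field.
case=> t _ <-; rewrite dotDr !dotZr [dot u (perp u)]dotC dot_perp_id.
by field.
Qed.

(** With this encoding, failure of collinearity supplies, for every nonzero [u], a point off any
    prescribed level. *)
Definition collinear (A : set 'rV[R]_2) :=
  exists2 u, u != 0 & exists c, forall x, A x -> dot u x = c.

Lemma collinear_line (A : set 'rV[R]_2) :
  collinear A -> exists L, is_line L /\ A `<=` L.
Proof.
case=> u u0 [c hc]; exists [set x | dot u x = c].
by split=> //; exact: is_line_level.
Qed.

Lemma not_collinear_off (A : set 'rV[R]_2) u x :
  ~ collinear A -> u != 0 -> exists2 y, A y & dot u y != dot u x.
Proof.
move=> nA u0; apply: contrapT => h; apply: nA; exists u => //.
exists (dot u x) => y Ay; apply: contrapT => /eqP hy; apply: h; exists y => //.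
Qed.

Definition no_ordinary_line (M : set 'rV[R]_2) :=
  forall L, is_line L -> ~ exists x y, x <> y /\ L `&` M = [set x; y].

(** The form in which the hypothesis on [M] is used: two known points on a level line force a third,
    which the callers then exclude. *)
Lemma ordinary_level (M : set 'rV[R]_2) u c x y :
  no_ordinary_line M -> u != 0 -> x != y -> M x -> M y ->
  dot u x = c -> dot u y = c ->
  exists z, [/\ M z, dot u z = c, z != x & z != y].
Proof.
move=> hM u0 xy Mx My ux uy; apply: contrapT => h.
apply: (hM _ (is_line_level c u0)); exists x, y; split; first exact/eqP.
apply/seteqP; split => z /=; last by case=> ->.
case=> uz Mz; apply: contrapT => /not_orP[/eqP zx /eqP zy].
by apply: h; exists z.
Qed.

(** * Perturbation of linear functionals on a finite set *)

(** A pair stands for an affine function of [s], given by its value at 0 and its slope; a nonzero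
    sign at 0 persists for small [s]. *)
Lemma small_perturbation (D : seq (R * R)) :
  exists2 s, 0 < s & forall d, d \in D ->
    (d.1 < 0 -> d.1 + s * d.2 < 0) /\ (0 < d.1 -> 0 < d.1 + s * d.2).
Proof.
(* Asking for all [s] up to a bound lets the induction take minima of bounds. *)
suff [e e0 he] : exists2 e : R, 0 < e & forall s, 0 < s <= e -> forall d, d \in D ->
    (d.1 < 0 -> d.1 + s * d.2 < 0) /\ (0 < d.1 -> 0 < d.1 + s * d.2).
  by exists e => // d; apply: he; rewrite e0 lexx.
elim: D => [|[p q] D [e e0 IH]]; first by exists 1.
have [p0|p0] := eqVneq p 0.
  exists e => // s hs d; rewrite inE => /predU1P[->|]; last exact: IH.
  by rewrite p0 /= ltxx.
have q1 : 0 < 1 + `|q| by rewrite ltr_pwDl.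
(* The summand 1 keeps the denominator positive and makes [s * |q| < |p|] strict. *)
exists (Num.min e (`|p| / (1 + `|q|))).
  by rewrite lt_min e0 divr_gt0 ?normr_gt0.
move=> s /andP[s0]; rewrite le_min ler_pdivlMr // => /andP[se sq] d.
rewrite inE => /predU1P[->|]; last by apply: IH; rewrite s0.
have : `|s * q| <= s * `|q| by rewrite normrM gtr0_norm.
rewrite ler_norml => /andP[hq1 hq2].
split => /= hp; first by rewrite (ltr0_norm hp) in sq; lra.
by rewrite (gtr0_norm hp) in sq; lra.
Qed.

(** For small [s] the functional [u + s *: v] orders [D] lexicographically: by [u], with ties broken
    by [v]. *)
Lemma perturb u v (D : seq 'rV[R]_2) :
  exists2 s, 0 < s & forall x y, x \in D -> y \in D ->
    (dot u x < dot u y -> dot (u + s *: v) x < dot (u + s *: v) y) /\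
    (dot u x = dot u y -> dot v x < dot v y ->
      dot (u + s *: v) x < dot (u + s *: v) y).
Proof.
have [s s0 hs] := small_perturbation
  [seq (dot u x - dot u y, dot v x - dot v y) | x <- D, y <- D].
exists s => // x y xD yD; rewrite !dotDl !dotZl; split => h.
  have [/= h1 _] := hs _ (allpairs_f _ xD yD); have {}h1 := h1 (ltac:(lra)); lra.
by rewrite h ltrD2l ltr_pM2l.
Qed.

Lemma exists_neq0 : exists u : 'rV[R]_2, u != 0.
Proof.
exists (const_mx 1); apply/eqP => /rowP/(_ 0); rewrite !mxE => /eqP.
by rewrite oner_eq0.
Qed.

(** Ties of [u] are broken by [perp u]; points tied under both coincide. *)
Lemma generic_perturbation u (D : seq 'rV[R]_2) : u != 0 ->
  exists u', [/\ u' != 0, {in D &, injective (dot u')} &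
    forall x y, x \in D -> y \in D -> dot u x < dot u y -> dot u' x < dot u' y].
Proof.
move=> u0; have [s s0 hs] := perturb u (perp u) D.
exists (u + s *: perp u); split.
- apply/eqP => /(congr1 (dot u)); rewrite dotDr dotZr [dot u (perp u)]dotC dot_perp_id.
  by move/eqP; rewrite mulr0 addr0 -(scale0r u) dotZr mul0r gt_eqF // dot_gt0.
- move=> x y xD yD h; apply: contrapT => xy.
  have [h1 h2] := hs x y xD yD; have [h3 h4] := hs y x yD xD.
  have [hu|hu|hu] := ltgtP (dot u x) (dot u y).
  + by move: (h1 hu); rewrite h ltxx.
  + by move: (h3 hu); rewrite h ltxx.
  have [hv|hv|hv] := ltgtP (dot (perp u) x) (dot (perp u) y).
  + by move: (h2 hu hv); rewrite h ltxx.
  + by move: (h4 (esym hu) hv); rewrite h ltxx.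
  apply: xy; apply/eqP; rewrite -subr_eq0; apply/eqP.
  by apply: (dot_eq0 u0); rewrite dotBr ?hu ?hv subrr.
- by move=> x y xD yD; case: (hs x y xD yD).
Qed.

(** * Vertices of the convex hull *)

Lemma seq_argmax (T : eqType) (g : T -> R) (D : seq T) (x0 : T) : x0 \in D ->
  exists2 x : T, x \in D & forall y : T, y \in D -> g y <= g x.
Proof.
elim: D x0 => // p [|q D] IH x0 _.
  by exists p; rewrite ?mem_head // => y; rewrite inE => /eqP ->.
have [x xD hx] := IH q (mem_head _ _).
have [hp|hp] := lerP (g p) (g x).
  by exists x => [|y]; rewrite inE ?xD ?orbT // => /predU1P[->|/hx].
exists p => [|y]; rewrite ?mem_head // inE => /predU1P[->//|/hx h].
exact: le_trans h (ltW hp).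
Qed.

Definition strict_max u (D : seq 'rV[R]_2) e :=
  e \in D /\ forall x, x \in D -> x != e -> dot u x < dot u e.

(** For a finite [D] these are the vertices of its convex hull. *)
Definition exposed (D : seq 'rV[R]_2) e := exists u, strict_max u D e.

Lemma injective_strict_max u (D : seq 'rV[R]_2) x0 :
  {in D &, injective (dot u)} -> x0 \in D -> exists e, strict_max u D e.
Proof.
move=> uI /(seq_argmax (dot u))[e eD he]; exists e; split=> // x xD xe.
by rewrite lt_neqAle he // andbT; apply: contra_neq xe => /uI; apply.
Qed.

(** A generic functional has its maximum and minimum at two vertices [x] and [y]. A functional
    constant on the line [xy], with some [p] of [D] strictly above it, has a generic perturbation
    whose maximum is a third vertex. *)
Lemma three_exposed (D : seq 'rV[R]_2) : ~ collinear [set` D] ->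
  exists x y z, [/\ exposed D x, exposed D y, exposed D z &
    [&& x != y, x != z & y != z]].
Proof.
move=> nD.
have [u1 u10] := exists_neq0.
have [u [u0 uI _]] := generic_perturbation D u10.
have [x1 x1D _] := not_collinear_off 0 nD u0.
have [x hx] := injective_strict_max uI x1D.
have NuI : {in D &, injective (dot (- u))}.
  by move=> p q pD qD; rewrite !dotNl => /oppr_inj; exact: uI.
have [y hy] := injective_strict_max NuI x1D.
have xy : x != y.
  apply/eqP => xy; have [z /= zD zx] := not_collinear_off x nD u0.
  have zx' : z != x by apply: contra_neq zx => ->.
  have := hx.2 z zD zx'; rewrite xy in zx'; have := hy.2 z zD zx'.
  rewrite !dotNl xy; lra.
have v0 : perp (y - x) != 0 by rewrite perp_neq0 // subr_eq0 eq_sym.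
have vxy : dot (perp (y - x)) y = dot (perp (y - x)) x.
  by apply/eqP; rewrite -subr_eq0 -dotBr dot_perp_id.
have [v [vn0 {}vxy [p pD vp]]] : exists v, [/\ v != 0, dot v y = dot v x &
    exists2 p, p \in D & dot v x < dot v p].
  have [p pD /=] := not_collinear_off x nD v0.
  rewrite neq_lt => /orP[] h.
    exists (- perp (y - x)); rewrite oppr_eq0 !dotNl vxy; split=> //.
    by exists p => //; rewrite !dotNl ltrN2.
  by exists (perp (y - x)); split=> //; exists p.
have [w [w0 wI hw]] := generic_perturbation D vn0.
have [z hz] := injective_strict_max wI pD.
have wpz : dot w p <= dot w z.
  by have [->|/(hz.2 p pD)/ltW] := eqVneq p z.
exists x, y, z; split; [by exists u|by exists (- u)|by exists w|].
rewrite xy /=; apply/andP; split; apply/eqP => h.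
  by have := hw x p hx.1 pD vp; rewrite h; lra.
by have := hw y p hy.1 pD; rewrite vxy h => /(_ vp); lra.
Qed.

(* Rotate a line about [e], starting from the line through [e] and [w], until
   it supports [D] ([slope] measures the rotation), then tilt it slightly so
   that [e] becomes the strict maximum. *)
Lemma exposed_second (D W : seq 'rV[R]_2) e w :
  ~ collinear [set` D] -> exposed D e -> w \in D -> w != e ->
  exists u f, [/\ u != 0, {in D ++ W &, injective (dot u)}, strict_max u D e,
    f \in D & [/\ f != e, ~ segment e w f &
      forall x, x \in D -> x != e -> x != f -> dot u x < dot u f]].
Proof.
move=> nD [p [eD pe]] wD we.
have k0 : perp (w - e) != 0 by rewrite perp_neq0 // subr_eq0.
have kw : dot (perp (w - e)) w = dot (perp (w - e)) e.
  by apply/eqP; rewrite -subr_eq0 -dotBr dot_perp_id.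
(* [k] is constant along the line through [e] and [w], with its sign chosen so that some point of
   [D] lies above that line. *)
have [k [{}kw [v vD kv]]] : exists k, dot k w = dot k e /\
    exists2 v, v \in D & dot k e < dot k v.
  have [v vD /=] := not_collinear_off e nD k0.
  rewrite neq_lt => /orP[] h.
    exists (- perp (w - e)); rewrite !dotNl kw; split=> //.
    by exists v => //; rewrite !dotNl ltrN2.
  by exists (perp (w - e)); split=> //; exists v.
have ve : v != e by apply: contraTneq kv => ->; rewrite ltxx.
pose D' := [seq x <- D | x != e].
(* [slope x] is the [s] at which [k + s *: p] takes equal values at [x] and [e]. At the largest
   slope, [e] becomes a maximum on [D]. *)
pose slope x := dot k (x - e) / dot p (e - x).
have pgt0 x : x \in D -> x != e -> 0 < dot p (e - x).
  by move=> xD xe; rewrite dotBr subr_gt0 pe.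
have vD' : v \in D' by rewrite mem_filter ve.
have [g] := seq_argmax slope vD'.
rewrite mem_filter => /andP[ge gD] hg.
pose q := k + slope g *: p.
have slope_gt0 : 0 < slope g.
  apply: lt_le_trans (hg v vD'); rewrite divr_gt0 ?pgt0 //.
  by rewrite dotBr subr_gt0.
have qe x : x \in D -> x != e -> dot q x <= dot q e.
  move=> xD xe; have := hg x; rewrite mem_filter xe xD => /(_ isT).
  rewrite {1}/slope ler_pdivrMr ?pgt0 // !dotBr.
  by rewrite /q !dotDl !dotZl; nra.
have qg : dot q g = dot q e.
  have /eqP : slope g * dot p (e - g) = dot k (g - e).
    by rewrite /slope divfK // gt_eqF // pgt0.
  by rewrite /q !dotDl !dotZl !dotBr => /eqP; nra.
have qw : dot q w < dot q e.
  by rewrite /q !dotDl !dotZl kw ltrD2l ltr_pM2l // pe.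
have [s s0 hs] := perturb q p D.
set r := q + s *: p in hs.
have re x : x \in D -> x != e -> dot r x < dot r e.
  move=> xD xe; have [h1 h2] := hs x e xD eD.
  have [hq|hq] := ltrP (dot q x) (dot q e); first exact: h1.
  by apply: h2; rewrite ?pe //; apply/le_anti; rewrite hq qe.
have rwg : dot r w < dot r g by apply: (hs w g wD gD).1; rewrite qg.
have r0 : r != 0.
  by apply: contraTneq rwg => ->; rewrite -(scale0r r) !dotZl !mul0r ltxx.
have [u [u0 uI hu]] := generic_perturbation (D ++ W) r0.
have DDW x : x \in D -> x \in D ++ W by move=> xD; rewrite mem_cat xD.
have gD' : g \in D' by rewrite mem_filter ge.
have [f] := seq_argmax (dot u) gD'; rewrite mem_filter => /andP[fe fD] hf.
exists u, f; split=> //.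
- by split=> // x xD xe; apply: hu; rewrite ?DDW ?re.
- split=> //.
    case=> t /=; rewrite in_itv /= => /andP[t0 _] ft.
    (* If [f] were below the top level of [q], then [g] would beat it under [r] and hence under [u].
       So [f] is on the top level, which the segment from [e] to [w] meets only in [e]. *)
    have qf : dot q f = dot q e.
      apply/le_anti; rewrite qe //= leNgt -qg; apply/negP => /(hs f g fD gD).1.
      by move/(hu f g (DDW _ fD) (DDW _ gD)); rewrite ltNge hf.
    have /eqP : t * (dot q e - dot q w) = 0.
      by move: qf; rewrite -ft dotDr !dotZr; lra.
    rewrite mulf_eq0 subr_eq0 (gt_eqF qw) orbF => /eqP t00.
    by move: fe; rewrite -ft t00 subr0 scale1r scale0r addr0 eqxx.
  move=> x xD xe xf; rewrite lt_neqAle hf ?mem_filter ?xe // andbT.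
  by apply: contra_neq xf; apply: uI; rewrite DDW.
Qed.

(** * Segments and level lines *)

Lemma segment_lt u c a b z :
  dot u a < c -> dot u b < c -> segment a b z -> dot u z < c.
Proof.
move=> ha hb [t /=]; rewrite in_itv /= => /andP[t0 t1] <-.
by rewrite dotDr !dotZr; have [h|/ltW h] := lerP (dot u a) (dot u b); nra.
Qed.

Lemma segment_level u c a b z :
  dot u a = c -> dot u b = c -> segment a b z -> dot u z = c.
Proof. by move=> ha hb [t _ <-]; rewrite dotDr !dotZr ha hb; ring. Qed.

(** If [f] is not an end of the segment, the level line misses the segment and the claim is vacuous;
    otherwise it touches the segment only at that end. *)
Lemma segment_touch u a b f z : a != b ->
  (a != f -> dot u a < dot u f) -> (b != f -> dot u b < dot u f) ->
  segment a b z -> dot u z = dot u f -> z = f.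
Proof.
move=> ab ha hb [t /=]; rewrite in_itv /= => /andP[t0 t1] <-.
rewrite dotDr !dotZr => h.
have [af|/ha {}ha] := eqVneq a f.
  have bf : b != f by rewrite -af eq_sym.
  have /eqP : t * (dot u b - dot u f) = 0 by rewrite af in h; lra.
  rewrite mulf_eq0 subr_eq0 (lt_eqF (hb bf)) orbF => /eqP ->.
  by rewrite subr0 scale1r scale0r addr0.
have [bf|/hb {}hb] := eqVneq b f.
  have /eqP : (1 - t) * (dot u a - dot u f) = 0 by rewrite bf in h; lra.
  rewrite mulf_eq0 (subr_eq0 (dot u a)) (lt_eqF ha) orbF subr_eq0 => /eqP <-.
  by rewrite subrr scale0r scale1r add0r.
suff : dot u ((1 - t) *: a + t *: b) < dot u f by rewrite dotDr !dotZr h ltxx.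
by apply: segment_lt ha hb _; exists t; rewrite //= in_itv /= t0.
Qed.

(** Along the segment [dot u - c] is affine and changes sign, so it has a single zero, strictly
    inside. *)
Lemma segment_cross u c a b : (dot u a - c) * (dot u b - c) < 0 ->
  exists x, [/\ segment_relint a b x, dot u x = c &
    forall z, segment a b z -> dot u z = c -> z = x].
Proof.
move=> h; have ab : dot u b - dot u a != 0.
  apply: contraTneq h => /eqP; rewrite subr_eq0 => /eqP ->.
  by rewrite -leNgt -expr2 sqr_ge0.
pose t := (c - dot u a) / (dot u b - dot u a).
have ht : t * (dot u b - dot u a) = c - dot u a by rewrite divfK.
have [t0 t1] : 0 < t /\ t < 1.
  have [hA|hA] := ltrP (dot u a) c.
    have hB : c < dot u b by nra.
    have d0 : 0 < dot u b - dot u a by lra.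
    by split; [rewrite -(pmulr_lgt0 _ d0)|rewrite -(ltr_pM2r d0)]; lra.
  have hB : dot u b < c by nra.
  have hA' : c < dot u a by nra.
  have d0 : dot u b - dot u a < 0 by lra.
  by split; [rewrite -(nmulr_llt0 _ d0)|rewrite -(ltr_nM2r d0)]; lra.
exists ((1 - t) *: a + t *: b); split.
- by exists t; rewrite //= in_itv /= t0.
- by rewrite dotDr !dotZr; lra.
- move=> _ [s _ <-]; rewrite dotDr !dotZr => hs.
  suff -> : s = t by [].
  by apply: (mulIf ab); rewrite ht; lra.
Qed.

Lemma relint_segment a b : segment_relint a b `<=` segment a b.
Proof.
move=> _ [t /= ht <-]; exists t => //=; move: ht; rewrite !in_itv /=.
by move=> /andP[/ltW-> /ltW->].
Qed.

Lemma segment_left a b : segment a b a.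
Proof.
by exists 0; rewrite /= ?in_itv /= ?lexx ?ler01 // subr0 scale1r scale0r addr0.
Qed.

Lemma segment_right a b : segment a b b.
Proof.
by exists 1; rewrite /= ?in_itv /= ?lexx ?ler01 // subrr scale0r scale1r add0r.
Qed.

Lemma relintC a b : segment_relint a b `<=` segment_relint b a.
Proof.
move=> _ [t /= ht <-]; exists (1 - t) => /=; last first.
  by rewrite addrC subKr.
by move: ht; rewrite !in_itv /= => /andP[h1 h2]; apply/andP; split; lra.
Qed.

Lemma relint_mid a b : segment_relint a b ((1 - 2^-1) *: a + 2^-1 *: b).
Proof. by exists 2^-1 => //=; rewrite in_itv /=; apply/andP; split; lra. Qed.

(** * The Sylvester-Gallai theorem for finite sets *)

(* Kelly's proof: minimize the distance [sqrt (- g (p, q, r))] from [r] to the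
   line [pq]. *)
Lemma sylvester_gallai (M : seq 'rV[R]_2) :
  no_ordinary_line [set` M] -> collinear [set` M].
Proof.
move=> hM; apply: contrapT => nM.
pose cr (T : 'rV[R]_2 * 'rV[R]_2 * 'rV[R]_2) :=
  dot (perp (T.1.2 - T.1.1)) (T.2 - T.1.1).
pose g T := - (cr T ^+ 2 / dot (T.1.2 - T.1.1) (T.1.2 - T.1.1)).
pose D := [seq T <- [seq (T, r) | T <- [seq (p, q) | p <- M, q <- M], r <- M] | cr T != 0].
have memD T : (T \in D) = [&& cr T != 0, T.1.1 \in M, T.1.2 \in M & T.2 \in M].
  rewrite mem_filter; case: (cr T != 0) => //=; apply/allpairsP/and3P.
    by case=> -[U r] /= [/allpairsP[[p q] /= [pM qM ->]] rM ->].
  case: T => [[p q] r] /= [pM qM rM]; exists ((p, q), r); split=> //.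
  exact: allpairs_f.
have [T0 T0D] : exists T, T \in D.
  have [u u0] := exists_neq0.
  have [p pM _] := not_collinear_off 0 nM u0.
  have [q qM /= qp] := not_collinear_off p nM u0.
  have v0 : perp (q - p) != 0.
    by rewrite perp_neq0 // subr_eq0; apply: contra_neq qp => ->.
  have [r rM /= rp] := not_collinear_off p nM v0.
  by exists (p, q, r); rewrite memD /cr /= dotBr subr_eq0 rp pM qM.
have [[[p q] r] /= TD hT] := seq_argmax g T0D.
move: TD; rewrite memD => /and4P[/= d0 pM qM rM].
set v := q - p; set d := dot (perp v) (r - p).
have {}d0 : d != 0 by [].
have v0 : v != 0.
  by apply: contraNneq d0; rewrite /d => ->; rewrite /dot perp0 perp1 !mxE; apply/eqP; ring.
have N0 := dot_gt0 v0; set N := dot v v in N0.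
have d2 : 0 < d ^+ 2 by rewrite exprn_even_gt0.
(* Position along the direction [v], up to scale, measured from the foot of the perpendicular from
   [r]. *)
pose h x := dot v (x - r).
(* By minimality, [x] is at least as far from the line [ry] as [r] is from the line [pq]. After
   clearing denominators this reads [h y ^+ 2 + d ^+ 2 <= (h x - h y) ^+ 2]. *)
have key x y : x \in M -> y \in M -> dot (perp v) x = dot (perp v) p ->
    dot (perp v) y = dot (perp v) p -> x != y -> 2 * (h x * h y) < h x ^+ 2.
  move=> xM yM hx hy xy.
  have ex : dot (perp v) (x - r) = - d by rewrite /d !dotBr hx opprB.
  have ey : dot (perp v) (y - r) = - d by rewrite /d !dotBr hy opprB.
  have NW : N * dot (y - r) (y - r) = h y ^+ 2 + d ^+ 2.
    rewrite -[d ^+ 2]sqrrN -ey /h /N.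
    by rewrite /dot perp0 perp1; ring.
  have NC : N * cr (r, y, x) = d * (h x - h y).
    have -> : d * (h x - h y) = h y * - d - (- d) * h x by ring.
    rewrite -{1}ex -ey /h /N /cr /=.
    by rewrite /dot !perp0 !perp1; ring.
  have W0 : 0 < dot (y - r) (y - r).
    by rewrite -(pmulr_rgt0 _ N0) NW ltr_wpDl ?sqr_ge0.
  have hxy : h x - h y != 0.
    apply: contra_neq xy => e; apply/eqP; rewrite -subr_eq0; apply/eqP.
    by apply: (dot_eq0 v0); move: e; rewrite /h !dotBr ?hx ?hy; lra.
  have c0 : cr (r, y, x) != 0.
    by rewrite -(mulrI_eq0 _ (mulfI (lt0r_neq0 N0))) NC mulf_neq0.
  have := hT (r, y, x); rewrite memD c0 rM yM xM => /(_ isT).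
  rewrite /g lerN2 /= -/v -/N ler_pdivrMr // mulrAC ler_pdivlMr //.
  rewrite -[cr (p, q, r)]/d => hle.
  have {}hle : d ^+ 2 * (h y ^+ 2 + d ^+ 2) <= d ^+ 2 * (h x - h y) ^+ 2.
    rewrite -exprMn -NC -NW.
    by have := ler_wpM2l (ltW N0) hle; lra.
  by move: hle; rewrite ler_pM2l //; lra.
have qp' : dot (perp v) q = dot (perp v) p.
  by apply/eqP; rewrite -subr_eq0 -dotBr dot_perp_id.
have pq : p != q by rewrite eq_sym -subr_eq0.
have [z [/= zM zp' zp zq]] :=
  @ordinary_level [set` M] _ _ p q hM (perp_neq0 v0) pq pM qM erefl qp'.
(* With [key] in both orders, two points of [M] on the line [pq] lie strictly on opposite sides of
   the foot, which is impossible for three points. *)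
have neg (s t : R) : 2 * (s * t) < s ^+ 2 -> 2 * (t * s) < t ^+ 2 -> s * t < 0.
  by move=> h1 h2; nra.
have n1 : h p * h q < 0 by apply: neg; apply: key; rewrite // eq_sym.
have n2 : h p * h z < 0 by apply: neg; apply: key; rewrite // eq_sym.
have n3 : h q * h z < 0 by apply: neg; apply: key; rewrite // eq_sym.
have pos : 0 < (h p * h q) * (h p * h z) by rewrite nmulr_rgt0.
have : h p ^+ 2 * (h q * h z) <= 0 by rewrite mulr_ge0_le0 ?sqr_ge0 // ltW.
by lra.
Qed.

End Plane.

(** * Counting incidences and separating a value from finitely many others *)

(** Inclusion-exclusion: the overlaps cost at most 3 in total. *)
Lemma card_setU3_ge (T : finType) (A B C : {set T}) (k : nat) :
  (k <= #|A|)%N -> (k <= #|B|)%N -> (k <= #|C|)%N ->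
  (#|A :&: B| <= 1)%N -> (#|A :&: C| <= 1)%N -> (#|B :&: C| <= 1)%N ->
  (3 * k <= #|T| + 3)%N.
Proof.
move=> hA hB hC hAB hAC hBC.
have h1 := cardsUI A B; have h2 := cardsUI (A :|: B) C.
have h3 : (#|(A :|: B) :&: C| <= 2)%N.
  by rewrite finset.setIUl; apply: leq_trans (leq_card_setU _ _) _; apply: leq_add hAC hBC.
have h4 : (#|A :|: B :|: C| <= #|T|)%N by exact: max_card.
lia.
Qed.

Lemma real_gap (R : realFieldType) (D : seq R) (m : R) :
  exists2 c, c < m & forall d, d \in D -> d < m -> d < c.
Proof.
elim: D => [|p D [c cm hc]]; first by exists (m - 1) => //; lra.
have [pm|mp] := ltrP p m; last first.
  exists c => // d; rewrite inE => /predU1P[->|]; last exact: hc.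
  by rewrite ltNge mp.
exists (Num.max c ((p + m) / 2)); first by rewrite gt_max cm; lra.
move=> d; rewrite inE lt_max => /predU1P[->|dD dm]; last by rewrite hc.
by move=> _; apply/orP; right; lra.
Qed.

(** * Segments ending at hull vertices *)

Section Family.
Variables (R : realType) (n : nat) (a b : 'I_n -> 'rV[R]_2).
Hypothesis hab : forall i, a i != b i.
Hypothesis hdisj : forall i j, i <> j ->
  segment_relint (a i) (b i) `&` segment_relint (a j) (b j) = set0.
Variable M : set 'rV[R]_2.
Hypothesis hFM : \bigcup_i segment (a i) (b i) `<=` M.
Variable W : seq 'rV[R]_2.
Hypothesis hW : forall z, M z -> z \in W \/ exists i, segment (a i) (b i) z.
Hypothesis hM : no_ordinary_line M.

Definition endpoints : seq 'rV[R]_2 := codom a ++ codom b.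

Definition incident (e : 'rV[R]_2) : {set 'I_n} :=
  [set i | (e == a i) || (e == b i)]%SET.

Lemma mem_a i : a i \in endpoints.
Proof. by rewrite mem_cat codom_f. Qed.

Lemma mem_b i : b i \in endpoints.
Proof. by rewrite mem_cat codom_f orbT. Qed.

Lemma endpointsP e : e \in endpoints -> exists i, i \in incident e.
Proof.
rewrite mem_cat => /orP[] /codomP[i ->]; exists i; rewrite inE eqxx //.
by rewrite orbT.
Qed.

Lemma segment_sub i z : segment (a i) (b i) z -> M z.
Proof. by move=> h; apply: hFM; exists i. Qed.

Lemma endpoints_sub e : e \in endpoints -> M e.
Proof.
rewrite mem_cat => /orP[] /codomP[i ->].
  exact: segment_sub (segment_left _ _).
exact: segment_sub (segment_right _ _).
Qed.

Lemma relint_neq i j x y : i != j ->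
  segment_relint (a i) (b i) x -> segment_relint (a j) (b j) y -> x != y.
Proof.
move=> /eqP ij hx hy; apply/eqP => xy.
have : (segment_relint (a i) (b i) `&` segment_relint (a j) (b j)) x.
  by split=> //; rewrite xy.
by rewrite hdisj.
Qed.

(** Two segments with the same two endpoints would share their midpoint, which is in both relative
    interiors. *)
Lemma incident_setI e f : e != f -> (#|incident e :&: incident f| <= 1)%N.
Proof.
move=> ef; apply/card_le1_eqP => i j.
rewrite !inE => /andP[ie if_] /andP[je jf]; apply/eqP; apply: contraT => ij.
have mid k : (e == a k) || (e == b k) -> (f == a k) || (f == b k) ->
    segment_relint (a k) (b k) ((1 - 2^-1) *: e + 2^-1 *: f).
  move=> /orP[]/eqP he /orP[]/eqP hf; try by rewrite he hf eqxx in ef.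
    by rewrite he hf; exact: relint_mid.
  by rewrite he hf; apply: relintC; exact: relint_mid.
by have := relint_neq ij (mid _ je jf) (mid _ ie if_); rewrite eqxx.
Qed.

Lemma exposed_card_neq2 e : exposed endpoints e -> #|incident e| != 2.
Proof.
case=> u [eV he]; apply/negP => /cards2P[i [j [ij hij]]].
(* The level [c] lies just below [e], avoiding [W] and leaving all other endpoints strictly below,
   so only segments ending at [e] reach it. *)
have [c ce hc] := real_gap [seq dot u x | x <- endpoints ++ W] (dot u e).
have {}hc x : x \in endpoints ++ W -> dot u x < dot u e -> dot u x < c.
  by move=> xV; apply: hc; exact: map_f.
have below x : x \in endpoints -> x != e -> dot u x < c.
  by move=> xV xe; apply: hc; rewrite ?he // mem_cat xV.
have cross k : k \in incident e -> exists x, [/\ segment_relint (a k) (b k) x,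
    dot u x = c & forall z, segment (a k) (b k) z -> dot u z = c -> z = x].
  rewrite inE => hk; apply: segment_cross; have abk := hab k.
  case/orP: hk => /eqP ek.
    have := below (b k) (mem_b k); rewrite ek eq_sym abk => /(_ isT).
    by rewrite ek in ce; nra.
  have := below (a k) (mem_a k); rewrite ek abk => /(_ isT).
  by rewrite ek in ce; nra.
have [|x [xr xc hx]] := cross i; first by rewrite hij !inE eqxx.
have [|y [yr yc hy]] := cross j; first by rewrite hij !inE eqxx orbT.
have u0 : u != 0.
  apply: contraTneq ce => u0; have := below (a i) (mem_a i); have := below (b i) (mem_b i).
  have abi := hab i; rewrite u0 -(scale0r 0) !dotZl !mul0r.
  by have [<-|] := eqVneq (a i) e; [rewrite eq_sym abi => /(_ isT)|move=> _ _ /(_ isT)] ; lra.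
have [z [Mz zc zx zy]] := ordinary_level hM u0 (relint_neq ij xr yr)
  (segment_sub (relint_segment xr)) (segment_sub (relint_segment yr)) xc yc.
have [zW|[k zk]] := hW Mz.
  by have := hc z; rewrite mem_cat zW orbT zc ltxx => /(_ isT ce).
have [ki|ki] := eqVneq k i; first by rewrite ki in zk; rewrite (hx z) ?eqxx in zx.
have [kj|kj] := eqVneq k j; first by rewrite kj in zk; rewrite (hy z) ?eqxx in zy.
have kn : k \notin incident e by rewrite hij !inE negb_or ki.
have : dot u z < c.
  move: kn; rewrite inE negb_or => /andP[ea eb].
  by apply: segment_lt zk; apply: below; rewrite ?mem_a ?mem_b // eq_sym.
by rewrite zc ltxx.
Qed.

Lemma exposed_card_neq1 e :
  ~ collinear [set` endpoints] -> exposed endpoints e -> #|incident e| != 1.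
Proof.
move=> nV he; apply/negP => /cards1P[i hi].
have abi := hab i.
have [w [wV we hw]] : exists w, [/\ w \in endpoints, w != e &
    e = a i /\ w = b i \/ e = b i /\ w = a i].
  have : i \in incident e by rewrite hi inE.
  rewrite inE => /orP[]/eqP ->; [exists (b i)|exists (a i)].
    by split; rewrite ?mem_b 1?eq_sym //; left.
  by split; rewrite ?mem_a //; right.
have [u [f [u0 uI [eV ue] fV [fe fT uf]]]] := exposed_second W nV he wV we.
have ufe : dot u f < dot u e by apply: ue.
have uwf : dot u w < dot u f.
  by apply: uf => //; apply/eqP => wf; apply: fT; rewrite -wf; exact: segment_right.
have [|x [xr xc hx]] := @segment_cross R u (dot u f) (a i) (b i).
  by case: hw => -[<- <-]; nra.
have xf : x != f.
  apply/eqP => xf; apply: fT; rewrite -xf; apply: relint_segment.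
  by case: hw => -[-> ->] //; exact: relintC.
have [z [Mz zc zx zf]] := ordinary_level hM u0 xf
  (segment_sub (relint_segment xr)) (endpoints_sub fV) xc erefl.
(* A point of [W] on the level of [f] is [f] by injectivity of [u]. A segment not ending at [e] has
   its endpoints other than [f] strictly below that level. *)
have [zW|[k zk]] := hW Mz.
  by move: zf; rewrite (uI z f) ?eqxx // mem_cat ?zW ?fV ?orbT.
have [ki|ki] := eqVneq k i; first by rewrite ki in zk; rewrite (hx z) ?eqxx in zx.
have : k \notin incident e by rewrite hi inE.
rewrite inE negb_or => /andP[ea eb].
have zf' : z = f.
  apply: (segment_touch _ _ _ zk zc); first exact: hab.
    by apply: uf; rewrite ?mem_a // eq_sym.
  by apply: uf; rewrite ?mem_b // eq_sym.
by rewrite zf' eqxx in zf.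
Qed.

Lemma exposed_card_ge3 e :
  ~ collinear [set` endpoints] -> exposed endpoints e -> (3 <= #|incident e|)%N.
Proof.
move=> nV he; have h1 := exposed_card_neq1 nV he; have h2 := exposed_card_neq2 he.
have [u [/endpointsP[i ie] _]] := he.
have : (0 < #|incident e|)%N by apply/card_gt0P; exists i.
by move: h1 h2; case: #|incident e| => [|[|[|]]].
Qed.

Lemma endpoints_collinear : (n <= 5)%N -> collinear [set` endpoints].
Proof.
move=> n5; apply: contrapT => nV.
have [x [y [z [hx hy hz /and3P[xy xz yz]]]]] := three_exposed nV.
(* This gives [9 <= n + 3], against [n <= 5]. *)
have := card_setU3_ge (exposed_card_ge3 nV hx) (exposed_card_ge3 nV hy)
  (exposed_card_ge3 nV hz) (incident_setI xy) (incident_setI xz) (incident_setI yz).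
by rewrite card_ord => h; move: (leq_trans h (leq_add n5 (leqnn 3))).
Qed.

(** * All segments on one line *)

Lemma collinear_of_endpoints : 'I_n -> collinear [set` endpoints] -> collinear M.
Proof.
move=> i [u u0 [c hu]]; exists u => //; exists c => q Mq; apply: contrapT => qc.
have segc k z : segment (a k) (b k) z -> dot u z = c.
  by apply: segment_level; apply: hu; rewrite /= ?mem_a ?mem_b.
have ac := hu _ (mem_a i); have bc := hu _ (mem_b i).
have abi := hab i.
(* For [x] at parameter [s] on segment [i], the cross product of [x - q] and [y - q] is affine in
   [s]; these are its value at 0 and its slope. The extra pair [(-1, 1)] below forces [s < 1]. *)
pose cross y := (dot (perp (a i - q)) (y - q), dot (perp (b i - a i)) (y - q)).
have [s s0 hs] := small_perturbation ((-1, 1) :: map cross W).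
have s1 : s < 1 by have [/= h _] := hs (-1, 1) (mem_head _ _); have := h (ltrN10 R); lra.
pose x := (1 - s) *: a i + s *: b i.
have xi : segment (a i) (b i) x by exists s => //=; rewrite in_itv /= !ltW.
have xc := segc _ _ xi.
have xq : x != q by apply/eqP => xq; apply: qc; rewrite -xq.
pose v := perp (x - q).
have v0 : v != 0 by rewrite perp_neq0 // subr_eq0.
have vxq : dot v x = dot v q by apply/eqP; rewrite -subr_eq0 -dotBr dot_perp_id.
have vE y : dot v (y - q) = dot (perp (a i - q)) (y - q) + s * dot (perp (b i - a i)) (y - q).
  by rewrite /v /x /dot !perp0 !perp1 !mxE; ring.
have [z [Mz zv zx zq]] := ordinary_level hM v0 xq (segment_sub xi) Mq vxq erefl.
have zv0 : dot v (z - q) = 0 by rewrite dotBr zv subrr.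
have [zW|[k zk]] := hW Mz.
  have zD : cross z \in (-1, 1) :: map cross W by rewrite inE map_f ?orbT.
  have [/= h1 h2] := hs _ zD.
  rewrite -vE zv0 in h1 h2.
  have [hz|hz|hz] := ltgtP (dot (perp (a i - q)) (z - q)) 0.
  - by have := h1 hz; rewrite ltxx.
  - by have := h2 hz; rewrite ltxx.
  (* Here [z - q] is parallel to both [a i - q] and [b i - a i], which puts [q] on the line of the
     segments. *)
  have hz2 : dot (perp (b i - a i)) (z - q) = 0.
    by apply/eqP; move/eqP: zv0; rewrite vE hz add0r mulf_eq0 gt_eqF.
  have ba0 : b i - a i != 0 by rewrite subr_eq0 eq_sym.
  have zq0 : z - q != 0 by rewrite subr_eq0.
  have uzq := dot_parallel ba0 hz2 (_ : dot u (b i - a i) = 0).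
  apply: qc; rewrite -ac; apply/eqP; rewrite eq_sym -subr_eq0 -dotBr; apply/eqP.
  apply: (dot_parallel zq0); last by apply: uzq; rewrite dotBr ac bc subrr.
  by rewrite dot_perp hz oppr0.
(* Now [x] and [z] are distinct points of the line of the segments, and [q] is collinear with
   them. *)
have zx0 : z - x != 0 by rewrite subr_eq0.
apply: qc; rewrite -xc; apply/eqP; rewrite eq_sym -subr_eq0 -dotBr; apply/eqP.
apply: (dot_parallel zx0); last by rewrite dotBr xc (segc _ _ zk) subrr.
by rewrite dot_perp -/v dotBr zv vxq subrr oppr0.
Qed.

End Family.

Theorem theorem6 (R : realType) (n : nat) (hn : (n <= 5)%N)
    (a b : 'I_n -> 'rV[R]_2)
    (hab : forall i, a i <> b i)
    (hdisj : forall i j, i <> j ->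
      segment_relint (a i) (b i) `&` segment_relint (a j) (b j) = set0)
    (M : set 'rV[R]_2)
    (hFM : \bigcup_i segment (a i) (b i) `<=` M)
    (hfin : finite_set (M `\` \bigcup_i segment (a i) (b i)))
    (hM : forall L, is_line L ->
      ~ exists x y : 'rV[R]_2, x <> y /\ L `&` M = [set x; y]) :
  exists L, is_line L /\ M `<=` L.
Proof.
have hab' i : a i != b i by exact/eqP/hab.
apply: collinear_line; have /finite_seqP[W hMW] := hfin.
have hW z : M z -> z \in W \/ exists i, segment (a i) (b i) z.
  move=> Mz; have [[i _ zi]|zn] := pselect ((\bigcup_i segment (a i) (b i)) z).
    by right; exists i.
  by left; have : [set` W] z by rewrite -hMW.
have [n0|n0] := posnP n; last first.
  apply: (collinear_of_endpoints hab' hFM hW hM (Ordinal n0)).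
  exact: (endpoints_collinear hab' hdisj hFM hW hM hn).
have MW : M = [set` W].
  apply/seteqP; split=> z; last by rewrite -hMW => -[].
  by case/hW => // -[i]; have := ltn_ord i; rewrite {2}n0.
by rewrite MW in hM *; exact: sylvester_gallai.
Qed.
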